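(* Let $p$ be an odd prime, $r$ a positive integer, and $m\neq 1$ a square-free rational integer not divisible by $p$, such that $F(x)=x^{p^r}-m$ is irreducible over $\mathbb{Q}$. Let $\alpha$ be a complex root of $F(x)$ and $K=\mathbb{Q}(\alpha)$. If $\nu_p(m^{p-1}-1)>p$ and $r\ge p$, then $K$ is not monogenic.
   Context: $\nu_p$ denotes the $p$-adic valuation. $K$ is called monogenic if its ring of integers $\mathbb{Z}_K$ equals $\mathbb{Z}[\theta]$ for some $\theta\in\mathbb{Z}_K$. *)

(* Defs.v *)
From HB Require Import structures.
From mathcomp Require Import all_boot all_order all_algebra all_field.
Set Implicit Arguments. Unset Strict Implicit. Unset Printing Implicit Defensive.
Import Order.TTheory GRing.Theory Num.Theory.
Local Open Scope ring_scope.

Definition squarefree_int (m : int) : Prop :=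
  forall q : nat, prime q -> ~~ (q ^ 2 %| `|m|)%N.

Definition in_Qadj (a x : algC) : Prop :=
  exists q : {poly rat}, x = (map_poly ratr q).[a].

Definition in_ring_of_integers (a x : algC) : Prop :=
  in_Qadj a x /\ x \in Aint.

Definition monogenic (a : algC) : Prop :=
  exists theta : algC, in_ring_of_integers a theta /\
    forall x : algC, in_ring_of_integers a x <->
      exists q : {poly int}, x = (map_poly intr q).[theta].

(* Main.v *)
(* Write m^(p^r) - m = p^(k+1) c with p <= k <= r, where k = r or p does not
   divide c. For 0 <= j <= k put S_j = alpha^(p^(r-k+j)) - m^(p^(r-k+j)), so
   that S_k = - p^(k+1) c, and W_j = - p^(j+1) c / S_j. The W_j are algebraic
   integers, and modulo the radical of p they form an increasing chain of
   idempotents ending at W_k = 1. Their differences e_j = W_j - W_(j-1) are thus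
   k+1 orthogonal idempotents; a trace computation shows that none vanishes.
   With t = alpha - m, which is nilpotent mod p, and M_0 = p^(r-k),
   M_j = p^(r-k+j-1) (p-1), the quotient t^(M_j) / p is a unit where e_j is
   (except for j = 0 when k = r, but then M_0 = 1 is a trivial bound below).
   If the ring of integers is Z[theta], let f be the minimal polynomial of theta.
   Each e_j then yields a root of f mod p of multiplicity at least M_j. As the M_j
   add up to p^r, there is exactly one root per j, so it is fixed by Frobenius:
   k+1 > p distinct elements of F_p, a contradiction. *)
Require Import Defs.
From HB Require Import structures.
From mathcomp Require Import all_boot all_order all_algebra all_field.
From mathcomp Require Import ring zify.
Import Order.TTheory GRing.Theory Num.Theory.
Local Open Scope ring_scope.

Set Implicit Arguments.
Unset Strict Implicit.
Unset Printing Implicit Defensive.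

Local Notation evi x g := (map_poly intr g).[x].

(** * Multiplicities of roots and the Frobenius map in characteristic p *)

Lemma sum_count_mem_le (T : eqType) (s rs : seq T) :
  uniq rs -> (\sum_(x <- rs) count_mem x s <= size s)%N.
Proof.
elim: s => [|y s IHs] Urs /=; first by rewrite big1.
rewrite big_split /= -add1n leq_add ?IHs //.
rewrite (eq_bigr (fun x => if x == y then 1 else 0)%N) => [|x _].
  by rewrite -big_mkcond sum1_count count_uniq_mem ?leq_b1.
by rewrite eq_sym; case: eqP.
Qed.

Lemma dvd_prod_XsubC_mup (L : fieldType) (s : seq L) (g : {poly L}) :
  g != 0 -> {in s, forall x, (count_mem x s <= mup x g)%N} ->
  \prod_(x <- s) ('X - x%:P) %| g.
Proof.
elim: s g => [|y s IHs] g gN0 le_s; first by rewrite big_nil dvd1p.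
have /dvdpP[h Dg]: 'X - y%:P %| g.
  rewrite XsubC_dvd //; apply: leq_trans (le_s y (mem_head _ _)).
  by rewrite /= eqxx.
have hN0: h != 0 by apply: contraNneq gN0 => h0; rewrite Dg h0 mul0r.
rewrite big_cons Dg mulrC dvdp_mul2r ?polyXsubC_eq0 // IHs // => x sx.
have := le_s x; rewrite inE sx orbT => /(_ isT) /=.
rewrite Dg mupM ?polyXsubC_eq0 // (@mup_XsubCX _ 1) eq_sym.
by case: eqP => _; rewrite ?addn0 ?add0n // add1n addn1 ltnS.
Qed.

(** If every x in [s] were a root of [v] or occurred at most [l] times, then [v ^+ size s] or
    [u ^+ l] would vanish at x to the order of its multiplicity, and the product would divide. This
    turns non-divisibility by p in Z[theta] into a root of f mod p of high multiplicity. *)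
Lemma non_dvd_root (L : fieldType) (s : seq L) (u v : {poly L}) l :
    {in s, forall x, root u x} ->
    ~~ (\prod_(x <- s) ('X - x%:P) %| u ^+ l * v ^+ size s) ->
  exists2 x, ~~ root v x & (l < count_mem x s)%N.
Proof.
move=> us0 ndv.
suff /hasP[x _ /andP[]]: has (fun x => ~~ root v x && (l < count_mem x s)%N) s.
  by exists x.
apply: contraR ndv => /hasPn no_x.
have [-> | gN0] := eqVneq (u ^+ l * v ^+ size s) 0; first exact: dvdp0.
have [ulN0 vsN0]: u ^+ l != 0 /\ v ^+ size s != 0.
  by apply/andP; rewrite -negb_or -mulf_eq0.
apply: dvd_prod_XsubC_mup => // x sx; rewrite mupM //.
have := no_x x sx; rewrite negb_and negbK -leqNgt => /orP[vx0 | le_l].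
  apply: leq_trans (leq_addl _ _); apply: leq_trans (count_size _ _) _.
  by rewrite mup_geq // dvdp_exp2r // dvdp_XsubCl.
apply: leq_trans (leq_addr _ _); apply: leq_trans le_l _.
by rewrite mup_geq // dvdp_exp2r // dvdp_XsubCl us0.
Qed.

(** The coefficients of f lie in the prime field, so the injective Frobenius map permutes the roots
    together with their multiplicities. *)
Lemma count_mem_frobenius (L : fieldType) (p : nat) (f : {poly int}) (s : seq L)
    (x : L) :
    p \in [pchar L] -> map_poly intr f = \prod_(y <- s) ('X - y%:P) ->
  count_mem (x ^+ p) s = count_mem x s.
Proof.
move=> charL Df; pose F := pFrobenius_aut charL.
have /prod_XsubC_eq/permP/(_ (pred1 (x ^+ p))) ->:
  \prod_(y <- s) ('X - y%:P) = \prod_(y <- map F s) ('X - y%:P).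
  have: map_poly F (map_poly intr f) = map_poly intr f.
    by apply/polyP=> i; rewrite !coef_map /= rmorph_int.
  rewrite Df rmorph_prod /= big_map => {1}<-; apply: eq_bigr => y _.
  by rewrite rmorphB /= map_polyX map_polyC.
rewrite count_map; apply: eq_count => y /=.
by rewrite -(pFrobenius_autE charL) (inj_eq (fmorph_inj F)).
Qed.

(* A root outside F_p would come with its distinct Frobenius conjugate, which
   has the same multiplicity and lies in the same class. *)
Lemma num_classes_le_prime (L : fieldType) (p : nat) (f : {poly int}) (s : seq L)
    (k : nat) (e : 'I_k -> {poly int}) (rho : 'I_k -> L) (E : 'I_k -> nat) :
    p \in [pchar L] -> map_poly intr f = \prod_(y <- s) ('X - y%:P) ->
    (forall i, 0 < E i)%N ->
    (forall i j x, i != j -> x \in s -> evi x (e i) * evi x (e j) = 0) ->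
    (forall i, evi (rho i) (e i) != 0) ->
    (forall i, E i <= count_mem (rho i) s)%N ->
    (size s <= \sum_i E i)%N ->
  (k <= p)%N.
Proof.
move=> charL Df E_gt0 e_orth e_rho le_E le_s.
have p_pr := pcharf_prime charL.
have s_rho i: rho i \in s by rewrite -has_pred1 has_count (leq_trans (E_gt0 i)).
have ev_frob (x : L) g: evi (x ^+ p) g = evi x g ^+ p.
  rewrite -(pFrobenius_autE charL).
  rewrite -{1}(_ : map_poly (pFrobenius_aut charL) (map_poly intr g) = map_poly intr g).
    by rewrite horner_map.
  by apply/polyP=> i; rewrite !coef_map /= rmorph_int.
have inj_rho: injective rho.
  move=> i j eq_ij; apply: contraTeq isT => /e_orth/(_ (s_rho i))/eqP.
  by rewrite mulf_eq0 {2}eq_ij !(negPf (e_rho _)).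
have rho_fix i: rho i ^+ p = rho i.
  apply: contraTeq le_s => nfix; rewrite -ltnNge.
  have s_frob: rho i ^+ p \in s.
    by rewrite -has_pred1 has_count (count_mem_frobenius _ charL Df) // -has_count has_pred1.
  have := @sum_count_mem_le _ s (rho i ^+ p :: map rho (enum 'I_k)).
  rewrite /= map_inj_uniq // enum_uniq andbT big_cons big_map big_enum /=.
  have ->: rho i ^+ p \notin map rho (enum 'I_k).
    apply/mapP=> [[j _ Dj]]; have [eq_ji | ji] := eqVneq j i.
      by rewrite Dj eq_ji eqxx in nfix.
    have /eqP := e_orth _ _ _ ji s_frob; rewrite mulf_eq0 {1}Dj (negPf (e_rho j)).
    by rewrite ev_frob expf_eq0 (negPf (e_rho i)) andbF.
  move=> /(_ isT); apply: leq_trans.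
  rewrite (count_mem_frobenius _ charL Df) // -[(\sum_i _).+1]add1n leq_add //.
    exact: leq_trans (E_gt0 i) (le_E i).
  by apply: leq_sum => j _; apply: le_E.
have XpX0: 'X^p - 'X != 0 :> {poly L}.
  apply/eqP => /(congr1 (coefp p)); rewrite /= coefB coefXn eqxx coefX coef0.
  rewrite gtn_eqF ?prime_gt1 //= subr0 => /eqP; exact/negP/oner_neq0.
have := @max_poly_roots _ _ (map rho (enum 'I_k)) XpX0.
rewrite map_inj_uniq // enum_uniq size_map size_enum_ord.
have ->: size ('X^p - 'X : {poly L}) = p.+1.
  by rewrite size_polyDl size_polyXn // size_polyN size_polyX ltnS prime_gt1.
rewrite ltnS; apply=> //; apply/allP=> _ /mapP[i _ ->].
by rewrite rootE !hornerE rho_fix subrr.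
Qed.

(** * Integer polynomials modulo p, minimal polynomials and conjugates *)

(** For the last clause, the quotient descends from L to F_p and is lifted to Z[X] coefficientwise;
    the remaining difference has coefficients divisible by p. When f is the minimal polynomial of
    theta, this makes g(theta) divisible by p in Z[theta]. *)
Lemma int_poly_splitting_mod (p : nat) (f : {poly int}) :
    prime p -> f \is monic ->
  exists (L : fieldType) (s : seq L), [/\ p \in [pchar L],
    map_poly intr f = \prod_(x <- s) ('X - x%:P) &
    forall g : {poly int}, map_poly intr f %| (map_poly intr g : {poly L}) ->
      exists h y : {poly int}, g = f * h + y *+ p].
Proof.
move=> p_pr mon_f; pose fb : {poly 'F_p} := map_poly intr f.
have mon_fb: fb \is monic by rewrite monic_map.
have [L [s]] := FinSplittingFieldFor (monic_neq0 mon_fb); rewrite -/fb => Ds _.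
have map_int (g : {poly int}) :
  map_poly (GRing.in_alg L) (map_poly intr g) = map_poly intr g.
  by apply/polyP=> i; rewrite !coef_map /= -[RHS](rmorph_int (GRing.in_alg L)).
rewrite map_int in Ds; exists L, s; split.
- by rewrite (rmorph_pchar (GRing.in_alg L)) ?pchar_Fp.
- by apply/eqP; rewrite -eqp_monic ?monic_map ?monic_prod_XsubC.
move=> g; rewrite -!map_int dvdp_map => /dvdpP[h Dg].
have [h1 Dh]: exists h1 : {poly int}, map_poly intr h1 = h.
  exists (map_poly (fun x : 'F_p => (x : nat)%:Z) h).
  apply/polyP=> i; rewrite coef_map coef_map_id0 //=.
  by rewrite -pmulrn natr_Zp.
exists h1; suff [y Dy]: exists y : {poly int}, g - f * h1 = y *+ p.
  by exists y; rewrite -Dy addrC subrK.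
exists (map_poly (fun x : int => (x %/ p)%Z) (g - f * h1)).
apply/polyP=> i; rewrite coefMn coef_map_id0 ?div0z //.
apply/esym; rewrite -mulr_natr natz divzK //.
have: (map_poly intr (g - f * h1) : {poly 'F_p})`_i = 0.
  by rewrite rmorphB rmorphM /= Dh Dg mulrC subrr coef0.
rewrite coef_map /=; move: (_`_i) => a; rewrite dvdzE /=.
have nat0 n: n%:R == 0 :> 'F_p -> (p %| n)%N by rewrite -(dvdn_pcharf (pchar_Fp p_pr)).
by case: a => n /eqP; rewrite ?NegzE ?mulrNz ?oppr_eq0 -pmulrn => /nat0.
Qed.

Local Notation evq x g := (map_poly ratr g).[x].

Lemma map_poly_ratr_intr (R : unitRingType) (g : {poly int}) :
  map_poly ratr (map_poly intr g : {poly rat}) = map_poly intr g :> {poly R}.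
Proof.
by apply/polyP=> i; rewrite !coef_map_id0 ?ratr_int /ratr ?mul0r // mulr0z mul0r.
Qed.

(** The last clause comes from division by the monic f over Z: a nonzero remainder would vanish at x
    with degree below that of the minimal polynomial. *)
Lemma Aint_minpoly (x : algC) :
    x \in Aint ->
  exists f : {poly int}, [/\ f \is monic, evi x f = 0,
    forall q : {poly rat}, q != 0 -> evq x q = 0 -> (size f <= size q)%N &
    forall g : {poly int}, evi x g = 0 -> exists h, g = f * h].
Proof.
have [q [Dq mon_q] min_q] := minCpolyP x; rewrite unfold_in /= => intq.
have [f Df]: exists f : {poly int}, map_poly intr f = q.
  have /polyOverP int_q: map_poly ratr q \is a polyOver (Num.int : {pred algC}).
    by rewrite -Dq; apply: intq.
  exists (map_poly numq q); apply/polyP=> i; rewrite coef_map coef_map_id0 //=.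
  by apply: numqK; have := int_q i; rewrite coef_map /= Cint_rat.
have mon_f: f \is monic.
  have := mon_q; rewrite -Df !monicE lead_coef_map_inj //; last exact: intr_inj.
  by rewrite (eqr_int _ _ 1).
have f0 : root (map_poly ratr q) x by rewrite min_q.
have fx0 : evi x f = 0.
  by have /eqP := f0; rewrite -Df map_poly_ratr_intr.
exists f; split=> //.
- move=> g gN0 gx0.
  have: q %| g by rewrite -min_q; apply/eqP.
  by move/(dvdp_leq gN0); rewrite -Df size_map_inj_poly //; apply: intr_inj.
move=> g gx0; exists (Pdiv.Ring.rdivp g f).
have Dg := Pdiv.RingMonic.rdivp_eq mon_f g.
rewrite {1}Dg mulrC; suff -> : Pdiv.Ring.rmodp g f = 0 by rewrite addr0.
apply/eqP; apply: contraT => rN0.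
have: q %| map_poly intr (Pdiv.Ring.rmodp g f).
  rewrite -min_q; apply/eqP; rewrite map_poly_ratr_intr.
  by move: gx0; rewrite {1}Dg rmorphD rmorphM !hornerE /= fx0 mulr0 add0r.
have szE := size_map_inj_poly (@intr_inj rat) (mulr0z 1).
move/dvdp_leq; rewrite -size_poly_eq0 -Df !szE size_poly_eq0 => /(_ rN0).
by rewrite leqNgt Pdiv.Ring.ltn_rmodpN0 ?monic_neq0.
Qed.

(** The n + 1 powers 1, h, ..., h^n, reduced modulo F, lie in a space of dimension n = deg F; a
    linear relation among them is q. It serves to bound the degree of theta. *)
Lemma rat_annihilator (F h : {poly rat}) (a : algC) :
    F != 0 -> evq a F = 0 ->
  exists q : {poly rat}, [/\ q != 0, (size q <= size F)%N & evq (evq a h) q = 0].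
Proof.
move=> FN0 Fa0; pose n := (size F).-1.
have sF: size F = n.+1 by rewrite prednK // lt0n size_poly_eq0.
pose A : 'M[rat]_(n.+1, n) := \matrix_i poly_rV ((h ^+ i) %% F).
have [v vN0 vA0]: exists2 v : 'rV_n.+1, v != 0 & v *m A = 0.
  have: (0 < \rank (kermx A))%N.
    by rewrite mxrank_ker subn_gt0 ltnS rank_leq_col.
  rewrite lt0n mxrank_eq0 => /rowV0Pn[v /sub_kermxP vA0 vN0]; by exists v.
exists (rVpoly v); split.
- by apply: contraNneq vN0 => v0; rewrite -[v]rVpolyK v0 linear0.
- by rewrite sF size_poly.
have evF (g : {poly rat}) : evq a (g %% F) = evq a g.
  by rewrite {2}(divp_eq g F) rmorphD rmorphM !hornerE /= Fa0 mulr0 add0r.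
have: rVpoly (v *m A) = 0 by rewrite vA0 linear0.
rewrite mulmx_sum_row linear_sum /= => /(congr1 (fun g => evq a g)).
rewrite rmorph_sum rmorph0 horner0 horner_sum => sum0; rewrite -[RHS]sum0.
rewrite [rVpoly v]poly_def rmorph_sum horner_sum; apply: eq_bigr => i _.
rewrite valK rowK linearZ /= -!mul_polyC !rmorphM /= !map_polyC !hornerM !hornerC.
have: (size (h ^+ i %% F)%R < size F)%N by rewrite ltn_modp.
rewrite sF ltnS => le_n; congr (_ * _); rewrite poly_rV_K //.
by rewrite evF !rmorphXn /= map_polyX !horner_exp hornerX.
Qed.

Lemma irreducible_root_transfer (F P : {poly rat}) (a b : algC) :
    irreducible_poly F -> evq a F = 0 -> evq b F = 0 -> evq a P = 0 ->
  evq b P = 0.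
Proof.
move=> irrF Fa0 Fb0 Pa0; have: F %| P.
  apply: contraT; rewrite -irreducible_poly_coprime // -(coprimep_map (ratr : rat -> algC)).
  by move/coprimep_root/(_ (introT eqP Fa0)); rewrite Pa0 eqxx.
by case/dvdpP=> Q ->; rewrite rmorphM hornerM Fb0 mulr0.
Qed.

(** * Algebraic integers nilpotent modulo p and their traces *)

Lemma dvdA_mull (e x y : algC) : x \in Aint -> (e %| y)%A -> (e %| x * y)%A.
Proof.
move=> Ax; rewrite !unfold_in; case: ifP => [_ /eqP-> | _]; first by rewrite mulr0.
by rewrite -mulrA => /(rpredM Ax).
Qed.

Lemma dvdA_expS (e x : algC) (m n : nat) :
  x \in Aint -> (m <= n)%N -> (e %| x ^+ m)%A -> (e %| x ^+ n)%A.
Proof. by move=> Ax /subnK<-; rewrite exprD; apply/dvdA_mull/rpredX. Qed.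

Lemma Aint_nilpotent_sum (e : algC) (n : nat) (u : 'I_n -> algC) :
    (forall i, u i \in Aint) -> (forall i, exists N, (e %| u i ^+ N)%A) ->
  exists N, (e %| (\sum_i u i) ^+ N)%A.
Proof.
move=> Au nil_u; pose nil x := x \in Aint /\ exists N, (e %| x ^+ N)%A.
suff [_ //]: nil (\sum_i u i).
apply: big_rec => [|i x _ [Ax [M eM]]].
  by split; [apply: rpred0 | exists 1; rewrite expr1 rpred0].
split; first exact: rpredD.
have [N eN] := nil_u i; exists (N + M)%N; rewrite exprDn rpred_sum // => j _.
rewrite rpredMn //; have [le_Mj | lt_jM] := leqP M j.
  by rewrite dvdA_mull ?rpredX // (dvdA_expS Ax le_Mj).
by rewrite mulrC dvdA_mull ?rpredX // (dvdA_expS (Au i) _ eN) //; lia.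
Qed.

Lemma dvdA_int_prime (p N : nat) (s : int) :
  prime p -> (p%:R %| s%:~R ^+ N)%A -> (p %| `|s|)%N.
Proof.
move=> p_pr; rewrite -eqAmod0 eqAmod0_rat ?rpred_nat ?rpredX ?rpred_int //.
by rewrite -rmorphXn dvdC_int ?rpred_int // intrKfloor abszX Euclid_dvdX // => /andP[].
Qed.

(** Since z^d is a primitive n-th root of unity, the geometric sums of z^(d l) vanish for 0 < l < n,
    and only the constant term of P survives. *)
Lemma sum_prim_root_powers (a z : algC) (d n : nat) (P : {poly algC}) :
    (d * n).-primitive_root z -> (size P <= n)%N ->
  \sum_(i < n) P.[(a * z ^+ i) ^+ d] = P`_0 *+ n.
Proof.
move=> prim_z sP; have dn_gt0 := prim_order_gt0 prim_z.
have [d_gt0 n_gt0]: (0 < d /\ 0 < n)%N by apply/andP; rewrite -muln_gt0.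
rewrite (eq_bigr (fun i : 'I_n =>
  \sum_(l < n) P`_l * (a ^+ d) ^+ l * (z ^+ (d * l)) ^+ i)); last first.
  move=> i _; rewrite (horner_coef_wide _ sP); apply: eq_bigr => l _.
  by rewrite !exprMn -mulrA; congr (_ * (_ * _)); rewrite -!exprM; congr (_ ^+ _); lia.
rewrite exchange_big /= (bigD1 (Ordinal n_gt0)) //= [X in _ + X]big1 ?addr0.
  under eq_bigr do rewrite muln0 expr0 expr1n !mulr1.
  by rewrite sumr_const card_ord.
move=> l lN0; rewrite -mulr_sumr; apply/eqP; rewrite mulf_eq0; apply/orP; right.
have zN1: z ^+ (d * l) - 1 != 0.
  rewrite subr_eq0 -(prim_order_dvd prim_z) dvdn_pmul2l //.
  by rewrite gtnNdvd // lt0n.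
rewrite -(inj_eq (mulfI zN1)) mulr0 -subrX1 -exprM subr_eq0.
by rewrite -(prim_order_dvd prim_z) mulnAC dvdn_mulr.
Qed.

(** The integer s is the trace of P(a^d) from Q(a^d) to Q, computed over the conjugates a z^i. By
    irreducibility the relation w^N = p g passes to each conjugate; a sum of elements nilpotent
    modulo p is again nilpotent, and an integer nilpotent modulo p is divisible by p. *)
Lemma dvdn_trace_nilpotent (p d n N : nat) (c : rat) (a theta : algC)
    (P : {poly rat}) (w g : {poly int}) (s : int) :
    prime p -> irreducible_poly ('X^(d * n) - c%:P) -> a ^+ (d * n) = ratr c ->
    in_ring_of_integers a theta -> (size P <= n)%N ->
    evi theta w = evq (a ^+ d) P -> evi theta w ^+ N = p%:R * evi theta g ->
    P`_0 *+ n = s%:~R ->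
  (p %| `|s|)%N.
Proof.
move=> p_pr irrF Da [[h Dtheta] Atheta] sP Dw DwN Ds.
have dn_gt0: (0 < d * n)%N.
  case: irrF => + _; case: (d * n)%N => // ; rewrite expr0 -polyC1 -polyCB.
  by rewrite ltnNge size_polyC_leq1.
have [z prim_z] := C_prim_root_exists dn_gt0.
pose b (i : 'I_n) := a * z ^+ i; pose th i := evq (b i) h.
have evF (x : algC) : x ^+ (d * n) = ratr c -> evq x ('X^(d * n) - c%:P) = 0.
  by rewrite rmorphB /= map_polyXn map_polyC !hornerE => ->; rewrite subrr.
have transfer i Q : evq a Q = 0 -> evq (b i) Q = 0.
  apply: irreducible_root_transfer irrF _ _; rewrite evF //.
  by rewrite exprMn Da exprAC (prim_expr_order prim_z) // expr1n mulr1.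
have ev_comp (x : algC) (q : {poly int}) :
    evq x (map_poly intr q \Po h) = evi (evq x h) q.
  by rewrite map_comp_poly horner_comp map_poly_ratr_intr.
have ev_compX (x : algC) (q : {poly rat}) : evq x (q \Po 'X^d) = evq (x ^+ d) q.
  by rewrite map_comp_poly horner_comp map_polyXn hornerXn.
have [f [mon_f f0 _ _]] := Aint_minpoly Atheta.
have Ath i : th i \in Aint.
  have: evi (th i) f = 0 by rewrite -ev_comp transfer // ev_comp -Dtheta.
  move/eqP/root_monic_Aint; apply; first by rewrite monic_map.
  by apply/polyOverP=> l; rewrite coef_map rpred_int.
have Aev i (q : {poly int}) : evi (th i) q \in Aint.
  by rewrite rpred_horner //; apply/polyOverP=> l; rewrite coef_map Aint_int.
have evw i : evi (th i) w = evq (b i ^+ d) P.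
  have /(transfer i): evq a ((map_poly intr w \Po h) - (P \Po 'X^d)) = 0.
    by rewrite rmorphB hornerD hornerN ev_comp ev_compX -Dtheta Dw subrr.
  by rewrite rmorphB hornerD hornerN ev_comp ev_compX => /eqP; rewrite subr_eq0 => /eqP.
have evwN i : evi (th i) w ^+ N = p%:R * evi (th i) g.
  have evE (x : algC) : evq x ((map_poly intr (w ^+ N - g *+ p)) \Po h)
      = evi (evq x h) w ^+ N - p%:R * evi (evq x h) g.
    rewrite ev_comp rmorphB rmorphXn rmorphMn /= hornerD hornerN horner_exp.
    by rewrite hornerMn mulr_natl.
  have := transfer i _ (etrans (evE a) _); rewrite evE -Dtheta DwN subrr.
  by move/(_ erefl)/eqP; rewrite subr_eq0 => /eqP.
have := @Aint_nilpotent_sum p%:R n (fun i => evi (th i) w) (fun i => Aev i w).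
case=> [i | M].
  exists N; rewrite evwN mulrC dvdA_mull //.
  by rewrite unfold_in; case: eqP => // /eqP pN0; rewrite divff // rpred1.
under eq_bigr do rewrite evw; rewrite sum_prim_root_powers ?size_map_poly //.
rewrite coef_map -rmorphMn Ds /= ratr_int; exact: dvdA_int_prime.
Qed.

(** * Binomial expansions of differences of p-power powers *)

(** All middle binomial coefficients are divisible by p, and that of the term linear in t equals p.
    This term is kept apart because it later provides the unit by which a power of t differs from
    p. *)
Lemma prime_exprDB (R : comNzRingType) (p : nat) (t b : R) :
    prime p ->
  exists y, (t + b) ^+ p - b ^+ p
    = t * (t ^+ p.-1 + p%:R * (b ^+ p.-1 + t * y)).
Proof.
case: p => [|[|n]] // p_pr; set p := n.+2.
exists (\sum_(i < n) ('C(p, i.+2) %/ p)%:R * b ^+ (n - i) * t ^+ i).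
rewrite [t + b]addrC exprDn big_ord_recl big_ord_recl big_ord_recr /=.
rewrite /bump /= !subSS subn0 subnn expr0 mulr1 bin0 mulr1n mul1r binn mulr1n.
rewrite bin1 expr1 subn0 addrAC subrr add0r.
rewrite (eq_bigr (fun i : 'I_n => t ^+ 2 * p%:R *
    (('C(p, i.+2) %/ p)%:R * b ^+ (n - i) * t ^+ i))) => [|i _]; last first.
  have p_dv: (p %| 'C(p, i.+2))%N by rewrite prime_dvd_bin //= !ltnS ltn_ord.
  rewrite !add1n !subSS -{1}(divnK p_dv) -mulr_natr natrM -[i.+2]addn2 exprD.
  by ring.
by rewrite -mulr_sumr -mulr_natr [t ^+ n.+2]exprS; ring.
Qed.

Lemma ppow_exprDB (R : comNzRingType) (p a : nat) (t b : R) :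
    prime p ->
  exists y, (t + b) ^+ (p ^ a) - b ^+ (p ^ a)
    = t ^+ (p ^ a) + p%:R * t * y.
Proof.
move=> p_pr; elim: a => [|a [y Dy]]; first by exists 0; rewrite expn0; ring.
have [n Dn]: exists n, (p ^ a = n.+1)%N.
  by exists (p ^ a).-1; rewrite prednK // expn_gt0 prime_gt0.
set B := b ^+ (p ^ a) in Dy *; set S := (t + b) ^+ (p ^ a) - B in Dy *.
have [z Dz] := prime_exprDB S B p_pr.
have [u Du] := prime_exprDB (p%:R * t * y) (t ^+ (p ^ a)) p_pr.
rewrite [_ + t ^+ _]addrC -Dy in Du; rewrite expnSr !exprM -/B.
rewrite -[(t + b) ^+ _](subrK B) -/S Dz mulrDr -exprS prednK ?prime_gt0 //.
rewrite -[S ^+ p](subrK (t ^+ (p ^ a) ^+ p)) Du.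
move: (_ ^+ p.-1) (B ^+ p.-1) (t ^+ _ ^+ p.-1) => v w x.
exists (y * (v + p%:R * (x + p%:R * t * y * u)) + (t ^+ n + p%:R * y) * (w + S * z)).
by rewrite [S in S * (p%:R * _)]Dy Dn [t ^+ n.+1]exprS; ring.
Qed.

(** The first form of the quotient of consecutive [S] makes the W_j an increasing chain, the second
    compares a power of t with p, and the expansion of [S a] itself gives the nilpotency of t modulo
    p. *)
Lemma ppow_exprDB_step (R : comNzRingType) (p a : nat) (t b : R) :
    prime p -> let S i := (t + b) ^+ (p ^ i) - b ^+ (p ^ i) in
  exists y z u,
   [/\ S a.+1 = S a * (S a ^+ p.-1 + p%:R * y),
       S a.+1 = S a * (t ^+ (p ^ a * p.-1)
                      + p%:R * (b ^+ (p ^ a * p.-1) + t * z)) &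
       S a = t ^+ (p ^ a) + p%:R * t * u].
Proof.
move=> p_pr S; have [u Du] := ppow_exprDB a t b p_pr.
have [x Dx] := prime_exprDB (S a) (b ^+ (p ^ a)) p_pr.
rewrite subrK -!exprM -expnSr -/(S _) in Dx.
have [n Dn]: exists n, (p ^ a = n.+1)%N.
  by exists (p ^ a).-1; rewrite prednK // expn_gt0 prime_gt0.
have DSt: S a = t * (t ^+ n + p%:R * u) by rewrite /S Du Dn exprS; ring.
have [v Dv]: exists v, S a ^+ p.-1 = t ^+ (p ^ a * p.-1) + p%:R * t * v.
  rewrite /S Du exprM; elim: p.-1 => [|q [v Dv]]; first by exists 0; ring.
  exists (u * (t ^+ (p ^ a)) ^+ q + v * (t ^+ (p ^ a) + p%:R * t * u)).
  by rewrite exprSr Dv exprS; ring.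
exists (b ^+ (p ^ a * p.-1) + S a * x), (v + (t ^+ n + p%:R * u) * x), u.
by split; [| rewrite Dx Dv [in S a * x]DSt; ring | ].
Qed.

(** * Integral equations for the quotients W_j *)

(** From i C(n, i) = n C(n-1, i-1) with n = p^h, the binomial coefficient has valuation at least h -
    v, where v is the valuation of i. As p >= 3 and i >= 2, also v + 2 <= i, and the bound
    follows. *)
Lemma dvdn_bin_ppow (p h j i : nat) :
    prime p -> odd p -> (1 < i)%N ->
  (p ^ (h + j + 2) %| 'C(p ^ h, i) * p ^ (j.+1 * i))%N.
Proof.
move=> p_pr p_odd i_gt1.
have p_gt2: (2 < p)%N by rewrite odd_prime_gt2.
have [C0 | C_gt0] := posnP 'C(p ^ h, i); first by rewrite C0 mul0n dvdn0.
rewrite pfactor_dvdn ?muln_gt0 ?expn_gt0 ?C_gt0 ?(prime_gt0 p_pr) //.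
rewrite lognM ?expn_gt0 ?(prime_gt0 p_pr) // (pfactorK _ p_pr).
have le_v: (logn p i + 2 <= i)%N.
  have: (p ^ logn p i <= i)%N by rewrite dvdn_leq ?pfactor_dvdnn // ltnW.
  case: (logn p i) => [|v] //; apply: leq_trans.
  have : (v < p ^ v)%N by rewrite ltn_expl // ltnW.
  by rewrite expnS; nia.
have le_h: (h <= logn p i + logn p 'C(p ^ h, i))%N.
  rewrite -lognM ?(ltnW i_gt1) //.
  case: (i) i_gt1 C_gt0 => // l _ C_gt0; rewrite -mul_bin_diag.
  rewrite -pfactor_dvdn ?dvdn_mulr // mul_bin_diag muln_gt0 C_gt0.
  by [].
nia.
Qed.

(* Multiplying the binomial expansion of (T + B)^(p^h) by W^(p^h) and using that
   W T is constant gives an equation for W whose coefficients turn out integral. *)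
Lemma integral_quotient_equation (p h j : nat) (B c : int) (T W : algC) :
    prime p -> odd p -> c != 0 ->
    (T + B%:~R) ^+ (p ^ h) - B%:~R ^+ (p ^ h) = - (p%:R ^+ (h + j).+1 * c%:~R) ->
    W * T = - (p%:R ^+ j.+1 * c%:~R) ->
  exists Y : {poly int}, (size Y < p ^ h)%N /\
    W ^+ (p ^ h) = B%:~R ^+ (p ^ h).-1 * W ^+ (p ^ h).-1 + p%:R * evi W Y.
Proof.
move=> p_pr p_odd cN0 DT DW; set n := (p ^ h)%N in DT *.
have pN0 : p%:R != 0 :> algC by rewrite pnatr_eq0 -lt0n prime_gt0.
have cN0' : c%:~R != 0 :> algC by rewrite intr_eq0.
have n_gt0: (0 < n)%N by rewrite expn_gt0 prime_gt0.
have /mulfI cancel: - (p%:R ^+ (h + j).+1 * c%:~R) != 0 :> algC.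
  by rewrite oppr_eq0 mulf_neq0 ?expf_neq0.
(* The common factor to cancel contains p^(h+j+1); dividing by one more power of p leaves the factor
   p in front of Y. *)
pose q i := ('C(n, i) * p ^ (j.+1 * i) %/ p ^ (h + j + 2))%N.
have Dq i : (1 < i)%N -> 'C(n, i)%:R * p%:R ^+ (j.+1 * i)
    = p%:R ^+ (h + j).+1 * (p%:R * (q i)%:R) :> algC.
  move=> i_gt1; rewrite mulrA -exprSr -!natrX -!natrM; congr _%:R.
  by rewrite [RHS]mulnC -addn2 divnK ?dvdn_bin_ppow.
exists (\poly_(l < n.-1) ((q (n - l)%N)%:R * B ^+ l * (- c) ^+ (n - l).-1)); split.
  by rewrite (leq_ltn_trans (size_poly _ _)) // ltn_predL.
apply: cancel; rewrite -{1}DT exprDn.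
have [m Dm]: exists m, n = m.+1 by exists n.-1; rewrite prednK.
rewrite Dm in q Dq *; rewrite !big_ord_recr /= subnn mul1r binn mulr1n.
rewrite addrK subSnn expr1 binSn poly_def rmorph_sum horner_sum /=.
rewrite [RHS]mulrDr [RHS]addrC mulrDl; congr (_ + _); last first.
  (* The term linear in T has coefficient p^h, so it gives exactly B^(n-1) W^(n-1). *)
  rewrite [W ^+ _]exprS -mulr_natr -Dm natrX -[in RHS]addnS exprD.
  transitivity (W * T * (p%:R ^+ h * B%:~R ^+ m * W ^+ m)); first by ring.
  by rewrite DW; ring.
rewrite mulrA mulr_suml mulr_sumr; apply: eq_bigr => i _.
have [d Dd]: exists d, (m.+1 - i)%N = d.+2.
  by exists (m.+1 - i).-2; have := ltn_ord i; lia.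
have DC: 'C(m.+1, i) = 'C(m.+1, d.+2) by rewrite -Dd bin_sub // ltnW // ltnS ltnW.
rewrite map_polyZ /= map_polyXn hornerZ hornerXn Dd DC -mulr_natr.
rewrite -{2}(subnK (_ : i <= m.+1)%N) ?Dd ?exprD; last by rewrite ltnW // ltnS ltnW.
transitivity ((W * T) ^+ d.+2 * ('C(m.+1, d.+2)%:R * (B%:~R ^+ i * W ^+ i))).
  by rewrite exprMn; ring.
rewrite DW -mulrN exprMn -exprM.
transitivity ('C(m.+1, d.+2)%:R * p%:R ^+ (j.+1 * d.+2)
  * ((- c%:~R) ^+ d.+2 * (B%:~R ^+ i * W ^+ i)) : algC); first by ring.
rewrite Dq //.
by rewrite !rmorphM !rmorphXn /= rmorphN rmorph_nat [(- _) ^+ d.+2]exprS; ring.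
Qed.

Lemma Aint_of_quotient_equation (W b : algC) (p n : nat) (Y : {poly int}) :
    (0 < n)%N -> b \in Num.int -> (size Y < n)%N ->
    W ^+ n = b * W ^+ n.-1 + p%:R * evi W Y ->
  W \in Aint.
Proof.
move=> n_gt0 intb sY DW.
pose Q : {poly algC} := b *: 'X^(n.-1) + p%:R *: map_poly intr Y.
have sQ: (size (- Q) <= n)%N.
  rewrite size_polyN (leq_trans (size_polyD _ _)) // geq_max.
  rewrite !(leq_trans (size_scale_leq _ _)) ?size_polyXn ?prednK //.
  by rewrite (leq_trans (size_poly _ _)) // ltnW.
have: root ('X^n - Q) W.
  by rewrite rootE !hornerE DW subrr.
move/root_monic_Aint; apply.
  by rewrite monicE lead_coefDl ?lead_coefXn // size_polyXn ltnS.
apply/polyOverP=> l; rewrite coefB coefXn coefD !coefZ coefXn coef_map /=.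
by rewrite rpredB ?rpredD ?rpredM ?rpred_nat ?rpred_int.
Qed.

(** * The choice of the level k *)

(** With M = m^(p-1), the difference factors as m (M - 1) (1 + M + ... + M^(s-1)), where s = 1 + p +
    ... + p^(r-1). As M = 1 mod p, the last factor is s = 1 mod p, so the valuation is that of M -
    1. *)
Lemma exists_level (p r : nat) (m : int) :
    prime p -> odd p -> ~~ (p %| `|m|)%N ->
    (p < logn p `|m ^+ (p - 1) - 1|)%N -> (p <= r)%N ->
  exists (k : nat) (c : int), [/\ (p <= k <= r)%N, c != 0,
    m ^+ (p ^ r) - m = p%:R ^+ k.+1 * c & k = r \/ ~~ (p %| `|c|)%N].
Proof.
move=> p_pr p_odd pm lt_nu le_pr; rewrite subn1 in lt_nu.
set M := m ^+ p.-1 in lt_nu; set nu := logn p _ in lt_nu.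
have r_gt0 : (0 < r)%N by apply: leq_trans le_pr; apply: prime_gt0.
pose s := (\sum_(i < r) p ^ i)%N.
have Ds : (p ^ r).-1 = (p.-1 * s)%N by rewrite predn_exp.
have DA : m ^+ (p ^ r) - m = m * (M - 1) * \sum_(i < s) M ^+ i.
  rewrite -mulrA -subrX1 -exprM -Ds mulrBr mulr1 -exprS prednK //.
  by rewrite expn_gt0 prime_gt0.
have pM1 : (p %| `|M - 1|)%N.
  by have := pfactor_dvdnn p `|M - 1|; apply/dvdn_trans/dvdn_exp/dvdnn; lia.
have ps : ~~ (p %| s)%N.
  rewrite /s; case: (r) r_gt0 => // r' _; rewrite big_ord_recl expn0 addnC.
  rewrite dvdn_addr; first by rewrite dvdn1 gtn_eqF // prime_gt1.
  by rewrite dvdn_sum // => i _; rewrite /= expnS dvdn_mulr.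
have pSig : ~~ (p %| `|(\sum_(i < s) M ^+ i)%R|)%N.
  have dvE (x : int) : (p %| `|x|)%N = (p%:Z %| x)%Z by rewrite dvdzE.
  apply: contra ps; rewrite -[s]/`|s%:Z|%N !dvE => pS.
  have ->: s%:Z = \sum_(i < s) M ^+ i - \sum_(i < s) (M ^+ i - 1).
    by rewrite sumrB opprB addrCA subrr addr0 sumr_const card_ord natz.
  by rewrite rpredB // rpred_sum // => i _; rewrite subrX1 dvdz_mulr // -dvE.
have A_neq0 : m ^+ (p ^ r) - m != 0.
  rewrite DA !mulf_neq0 //.
  - by apply: contraNneq pm => ->.
  - by apply: contraTneq lt_nu => M1; rewrite /nu M1 logn0.
  by apply: contraNneq pSig => ->.
have logA : logn p `|m ^+ (p ^ r) - m| = nu.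
  have cop x : ~~ (p %| `|x|)%N -> coprime p `|x| by rewrite prime_coprime.
  by rewrite DA !abszM -mulnA logn_Gauss ?cop // mulnC logn_Gauss ?cop.
have [k [k_bnd le_k k_max]]: exists k, [/\ (p <= k <= r)%N, (k < nu)%N & k = r \/ nu = k.+1].
  (* The minimum makes p^(k+1) divide the difference; if it is not r, then k + 1 is the full
     valuation and c is prime to p. *)
  by exists (minn r nu.-1); clearbody nu; clear -lt_nu le_pr; split; lia.
have := pfactor_dvdn k.+1 p_pr (_ : 0 < `|m ^+ (p ^ r) - m|)%N.
rewrite logA le_k absz_gt0 => /(_ A_neq0) dvA.
have /dvdzP[c Dc] : (p%:Z ^+ k.+1 %| m ^+ (p ^ r) - m)%Z by rewrite dvdzE abszX.
exists k, c; split.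
- exact: k_bnd.
- by apply: contraNneq A_neq0 => c0; rewrite Dc c0 mul0r.
- by rewrite mulrC natz.
case: k_max => [-> | Dnu]; [by left | right].
apply/negP => /dvdnP[d Dd].
have: (p ^ nu.+1 %| `|m ^+ (p ^ r) - m|)%N.
  by rewrite Dc abszM abszX Dd Dnu -mulnA -[(p * _)%N]expnS dvdn_mull.
by rewrite (pfactor_dvdn _ p_pr) ?absz_gt0 ?A_neq0 // logA ltnn.
Qed.

(** * Fermat congruences and the construction of the quotients W_j *)

Lemma intr_exp_ppow_pred (L : fieldType) (p h : nat) (b : int) :
    p \in [pchar L] -> ~~ (p %| `|b|)%N -> b%:~R ^+ (p ^ h).-1 = 1 :> L.
Proof.
move=> charL pb; have p_pr := pcharf_prime charL.
have bN0 : b%:~R != 0 :> L.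
  apply: contra pb; case: b => n; rewrite ?NegzE ?mulrNz ?oppr_eq0 -pmulrn.
    by rewrite -(dvdn_pcharf charL).
  by rewrite -(dvdn_pcharf charL) abszN.
apply: (mulfI bN0); rewrite mulr1 -exprS prednK ?expn_gt0 ?prime_gt0 //.
elim: h => [|h IHh]; first by rewrite expr1.
by rewrite expnSr exprM IHh -(pFrobenius_autE charL) /= rmorph_int.
Qed.

(* Up to the factor p^h, P is the geometric sum (Z^(p^h) - B^(p^h)) / (Z - B).
   All its conjugates under Z |-> zeta Z, zeta^(p^h) = 1, add up to its constant
   term times p^h. *)
Lemma quotient_by_root_diff (p h j : nat) (B c : int) (Z : algC) :
    prime p -> odd p -> c != 0 ->
    Z ^+ (p ^ h) - B%:~R ^+ (p ^ h) = - (p%:R ^+ (h + j).+1 * c%:~R) ->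
  exists (W : algC) (P : {poly rat}) (Y : {poly int}),
  [/\ [/\ W * (Z - B%:~R) = - (p%:R ^+ j.+1 * c%:~R), Z - B%:~R != 0 & W \in Aint],
      [/\ W = evq Z P, (size P <= p ^ h)%N &
           P`_0 *+ (p ^ h) = (B ^+ (p ^ h).-1)%:~R] &
      W ^+ (p ^ h) = B%:~R ^+ (p ^ h).-1 * W ^+ (p ^ h).-1 + p%:R * evi W Y].
Proof.
move=> p_pr p_odd cN0 DZ; pose S := Z - B%:~R; pose n := (p ^ h)%N.
have n_gt0 : (0 < n)%N by rewrite expn_gt0 prime_gt0.
have pN0 : p%:R != 0 :> algC by rewrite pnatr_eq0 -lt0n prime_gt0.
have nN0 : n%:R != 0 :> rat by rewrite pnatr_eq0 -lt0n.
have cN0' : c%:~R != 0 :> algC by rewrite intr_eq0.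
have SN0 : S != 0.
  apply: contraTneq (mulf_neq0 (expf_neq0 (h + j).+1 pN0) cN0') => S0.
  by rewrite -oppr_eq0 -DZ subrXX -/S S0 mul0r eqxx.
pose W := - (p%:R ^+ j.+1 * c%:~R) / S.
have DW : W * S = - (p%:R ^+ j.+1 * c%:~R) by rewrite divfK.
pose P : {poly rat} := \poly_(l < n) ((B ^+ (n.-1 - l))%:~R / n%:R).
have DWP : W = evq Z P.
  have DnP : n%:R * evq Z P = \sum_(i < n) B%:~R ^+ (n.-1 - i) * Z ^+ i.
    rewrite /P poly_def rmorph_sum horner_sum mulr_sumr /=; apply: eq_bigr => i _.
    rewrite map_polyZ /= map_polyXn hornerZ hornerXn fmorph_div rmorph_nat /=.
    by rewrite ratr_int natrX !rmorphXn /=; field; apply: expf_neq0.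
  have nN0' : n%:R != 0 :> algC by rewrite pnatr_eq0 -lt0n.
  apply: (mulIf SN0); apply: (mulfI nN0'); rewrite DW [RHS]mulrA DnP.
  have -> : n%:R * - (p%:R ^+ j.+1 * c%:~R) = - (p%:R ^+ (h + j).+1 * c%:~R) :> algC.
    by rewrite natrX mulrN mulrA -exprD addnS.
  by rewrite -DZ -opprB subrXX -mulNr opprB mulrC.
have [Y [sY DY]] := @integral_quotient_equation p h j B c S W p_pr p_odd cN0
  (etrans (congr1 (fun x => x ^+ _ - _) (subrK _ _)) DZ) DW.
exists W, P, Y; split=> //; first split=> //.
  by apply: (Aint_of_quotient_equation _ _ sY DY); rewrite ?rpredX ?rpred_int.
split=> //; first exact: size_poly.
by rewrite coef_poly n_gt0 subn0 -[LHS]mulr_natr divfK.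
Qed.

(** * The contradiction at a fixed level k *)

Lemma not_monogenic_of_level (p r k : nat) (m c : int) (alpha : algC) :
    prime p -> odd p -> ~~ (p %| `|m|)%N ->
    irreducible_poly ('X^(p ^ r) - (m%:~R)%:P : {poly rat}) ->
    alpha ^+ (p ^ r) = m%:~R ->
    (p <= k <= r)%N -> c != 0 -> m ^+ (p ^ r) - m = p%:R ^+ k.+1 * c ->
    k = r \/ ~~ (p %| `|c|)%N ->
  ~ monogenic alpha.
Proof.
move=> p_pr p_odd pm irrF Dalpha /andP[le_pk le_kr] cN0 Dc k_max.
case=> theta [Otheta gen].
have [[h Dtheta] Atheta] := Otheta.
have pN0 : p%:R != 0 :> algC by rewrite pnatr_eq0 -lt0n prime_gt0.
have p_gt1 := prime_gt1 p_pr; have p_gt2 : (2 < p)%N by rewrite odd_prime_gt2.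
have p1_gt0 : (0 < p.-1)%N by rewrite -ltnS prednK ?prime_gt0.
have lift x : x \in Aint -> in_Qadj alpha x -> exists w : {poly int}, x = evi theta w.
  by move=> Ax Qx; apply/gen; split.
have [a Da] : exists a : {poly int}, alpha = evi theta a.
  apply: lift; last by exists 'X; rewrite map_polyX hornerX.
  have := root_monic_Aint (_ : root ('X^(p ^ r) - (m%:~R)%:P) alpha); apply.
  - by rewrite rootE !hornerE Dalpha subrr.
  - by rewrite monicXnsubC // expn_gt0 prime_gt0.
  apply/polyOverP=> l; rewrite coefB coefXn coefC rpredB ?rpred_nat //.
  by case: ifP => _; rewrite ?rpred_int ?rpred0.
have [f [mon_f f0 min_f dv_f]] := Aint_minpoly Atheta.
have sz_f : (size f <= (p ^ r).+1)%N.
  have [||q [qN0 sq q0]] := @rat_annihilator ('X^(p ^ r) - (m%:~R)%:P) h alpha.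
  - exact: irredp_neq0.
  - by rewrite rmorphB /= map_polyXn map_polyC !hornerE Dalpha /= ratr_int subrr.
  rewrite -Dtheta in q0; apply: leq_trans (min_f q qN0 q0) (leq_trans sq _).
  by rewrite size_XnsubC // expn_gt0 prime_gt0.
have [L [s [charL Df split_f]]] := int_poly_splitting_mod p_pr mon_f.
have le_s : (size s <= p ^ r)%N.
  rewrite -ltnS -(size_prod_XsubC s id) -Df size_map_poly_id0 //.
  by rewrite (monicP mon_f) oner_eq0.
have pL0 : p%:R = 0 :> L := pcharf0 charL.
(* Identities at theta pass to every root of f in L, because g - g' is then a multiple of f. *)
have red (x : L) g g' : x \in s -> evi theta g = evi theta g' -> evi x g = evi x g'.
  move=> sx /eqP; rewrite -subr_eq0 -hornerN -hornerD -rmorphB /= => /eqP/dv_f[q Dq].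
  apply/eqP; rewrite -subr_eq0 -hornerN -hornerD -rmorphB /= Dq rmorphM /= hornerM Df.
  by have /rootP -> : root (\prod_(y <- s) ('X - y%:P)) x; rewrite ?root_prod_XsubC ?mul0r.
(* In the other direction, divisibility by f over L yields divisibility by p in Z[theta]. *)
have dvd_lift g : \prod_(y <- s) ('X - y%:P) %| map_poly intr g ->
    exists y, evi theta g = p%:R * evi theta y.
  rewrite -Df => /split_f[q [y ->]]; exists y.
  by rewrite rmorphD rmorphM rmorphMn /= hornerD hornerM hornerMn f0 mul0r add0r mulr_natl.
(* At theta, [t] and [S i] take the values alpha - m and alpha^(p^i) - m^(p^i); thus S_j is the
   value of [S (d j)]. *)
pose t := a - m%:P; pose S i := (t + m%:P) ^+ (p ^ i) - m%:P ^+ (p ^ i).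
pose d j := (r - k + j)%N.
have evS i : evi theta (S i) = alpha ^+ (p ^ i) - (m ^+ (p ^ i))%:~R.
  rewrite /S subrK rmorphB !rmorphXn /= map_polyC hornerD hornerN !horner_exp hornerC.
  by rewrite -Da.
have stepS i : exists y z u : {poly int},
  [/\ S i.+1 = S i * (S i ^+ p.-1 + p%:R * y),
      S i.+1 = S i * (t ^+ (p ^ i * p.-1) + p%:R * (m%:P ^+ (p ^ i * p.-1) + t * z)) &
      S i = t ^+ (p ^ i) + p%:R * t * u].
  exact: ppow_exprDB_step.
clearbody S t.
have Dd j : (j <= k)%N -> (p ^ d j * p ^ (k - j) = p ^ r)%N.
  by move=> le_jk; rewrite -expnD; congr (_ ^ _)%N; rewrite /d; clear -le_jk le_kr; lia.
have: forall j : 'I_k.+1, exists (w : {poly int}) (P : {poly rat}) (Y : {poly int}),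
  [/\ [/\ evi theta w * evi theta (S (d j)) = - (p%:R ^+ j.+1 * c%:~R),
          evi theta (S (d j)) != 0, (size P <= p ^ (k - j))%N &
          evi theta w = evq (alpha ^+ (p ^ d j)) P],
      P`_0 *+ (p ^ (k - j)) = ((m ^+ (p ^ d j)) ^+ (p ^ (k - j)).-1)%:~R &
      evi theta (w ^+ (p ^ (k - j))) = evi theta
        (((m ^+ (p ^ d j)) ^+ (p ^ (k - j)).-1)%:P * w ^+ (p ^ (k - j)).-1 + (Y \Po w) *+ p)].
  move=> j; have le_jk : (j <= k)%N by rewrite -ltnS.
  (* Here Z = alpha^(p^(d j)), B = m^(p^(d j)) and h = k - j, so that Z^(p^h) - B^(p^h) = m -
     m^(p^r). *)
  have [|W [P [Y [[DW SN0 AW] [DWP sP P0] DY]]]] :=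
    @quotient_by_root_diff p (k - j) j (m ^+ (p ^ d j)) c (alpha ^+ (p ^ d j)) p_pr p_odd cN0.
    rewrite -exprM -rmorphXn /= -exprM Dd // Dalpha subnK // -opprB -rmorphB /= Dc.
    by rewrite rmorphM rmorphXn /= rmorph_nat.
  have [w Dw] : exists w, W = evi theta w.
    apply: lift => //; exists (P \Po 'X^(p ^ d j)).
    by rewrite map_comp_poly horner_comp map_polyXn hornerXn.
  exists w, P, Y; rewrite evS; split; last 1 first.
  - rewrite rmorphD rmorphMn rmorphM /= map_polyC map_comp_poly /= hornerD.
    rewrite hornerMn hornerM hornerC horner_comp !rmorphXn /= !horner_exp -Dw.
    by rewrite -mulr_natl DY !rmorphXn /=.
  - by rewrite -Dw.
  by [].
move/fin_all_exists=> [w' /fin_all_exists[P' /fin_all_exists[Y' data']]].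
pose w j := w' (inord j); pose P j := P' (inord j); pose Y j := Y' (inord j).
have data j : (j <= k)%N ->
  [/\ [/\ evi theta (w j) * evi theta (S (d j)) = - (p%:R ^+ j.+1 * c%:~R),
          evi theta (S (d j)) != 0, (size (P j) <= p ^ (k - j))%N &
          evi theta (w j) = evq (alpha ^+ (p ^ d j)) (P j)],
      (P j)`_0 *+ (p ^ (k - j)) = ((m ^+ (p ^ d j)) ^+ (p ^ (k - j)).-1)%:~R &
      evi theta (w j ^+ (p ^ (k - j))) = evi theta
        (((m ^+ (p ^ d j)) ^+ (p ^ (k - j)).-1)%:P * w j ^+ (p ^ (k - j)).-1
         + (Y j \Po w j) *+ p)].
  by move=> le_jk; have := data' (inord j); rewrite inordK.
have pmX i : ~~ (p %| `|m ^+ i|)%N.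
  by rewrite abszX; apply: contra pm; rewrite Euclid_dvdX // => /andP[].
have evX (R : comNzRingType) (x : R) (g : {poly int}) n : evi x (g ^+ n) = evi x g ^+ n.
  by rewrite rmorphXn /= horner_exp.
have evM (R : comNzRingType) (x : R) (g g' : {poly int}) : evi x (g * g') = evi x g * evi x g'.
  by rewrite rmorphM /= hornerM.
have evD (R : comNzRingType) (x : R) (g g' : {poly int}) : evi x (g + g') = evi x g + evi x g'.
  by rewrite rmorphD /= hornerD.
have evB (R : comNzRingType) (x : R) (g g' : {poly int}) : evi x (g - g') = evi x g - evi x g'.
  by rewrite rmorphB /= hornerD hornerN.
have evC (R : comNzRingType) (x : R) (b : int) : evi x b%:P = b%:~R.
  by rewrite map_polyC hornerC.
have evMn (R : comNzRingType) (x : R) (g : {poly int}) n : evi x (g *+ n) = evi x g *+ n.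
  by rewrite rmorphMn /= hornerMn.
have evn (R : comNzRingType) (x : R) n : evi x (n%:R : {poly int}) = n%:R.
  by rewrite rmorph_nat -[X in X.[_]]polyC_natr hornerC.
have evN (R : comNzRingType) (x : R) (g : {poly int}) : evi x (- g) = - evi x g.
  by rewrite rmorphN /= hornerN.
have evE := (evX, evM, evD, evB, evN, evC, evMn, evn).
(* In L the equation reads W^n = W^(n-1) with n = p^(k-j), since the coefficient, a power of m,
   becomes 1. For j = k it forces the value 1. *)
have x01 (rho : L) j : rho \in s -> (j <= k)%N -> evi rho (w j) = 0 \/ evi rho (w j) = 1.
  move=> s_rho /data[_ _ /(red _ _ _ s_rho)]; rewrite !evE (mulrn_pchar charL).
  rewrite addr0 rmorphXn /= (intr_exp_ppow_pred _ charL (pmX _)) mul1r.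
  have n_gt0 : (0 < p ^ (k - j))%N by rewrite expn_gt0 prime_gt0.
  rewrite -{1}(prednK n_gt0) exprS => /eqP; rewrite -subr_eq0 -{2}[_ ^+ _]mul1r -mulrBl.
  rewrite mulf_eq0 => /orP[].
    by rewrite subr_eq0 => /eqP; right.
  by rewrite expf_eq0 => /andP[_ /eqP]; left.
have dS j : d j.+1 = (d j).+1 by rewrite /d addnS.
(* [S r] is m - m^(p^r) at theta, hence divisible by p, and it is congruent to t^(p^r) modulo p. *)
have t0 (rho : L) : rho \in s -> evi rho t = 0.
  move=> s_rho; have [_ [_ [u [_ _ Du]]]] := stepS r.
  have: evi theta (S r) = evi theta (- (p%:R ^+ k.+1 * c%:P)).
    by rewrite evS Dalpha -rmorphB -opprB Dc !evE rmorphN rmorphM rmorphXn /= rmorph_nat.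
  move/(red _ _ _ s_rho)/eqP; rewrite Du !evE pL0 exprS !mul0r oppr0 addr0.
  by rewrite expf_eq0 => /andP[_ /eqP].
(* Comparing W_j S_j = -p^(j+1) c with the same relation at j + 1 gives W_(j+1) (S_(j+1) / S_j) = p
   W_j; both forms of the quotient are then inserted. *)
have stepW j : (j < k)%N -> exists y z : {poly int},
  evi theta (w j.+1 * (S (d j) ^+ p.-1 + p%:R * y)) = evi theta (w j *+ p) /\
  evi theta (w j.+1 * (t ^+ (p ^ d j * p.-1) + p%:R * ((m ^+ (p ^ d j * p.-1))%:P + t * z)))
   = evi theta (w j *+ p).
  move=> lt_jk; have [y [z [_ [D1 D2 _]]]] := stepS (d j).
  have [[DW SN0 _ _] _ _] := data j (ltnW lt_jk).
  have [[DW1 _ _ _] _ _] := data j.+1 lt_jk.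
  have eqS : evi theta (w j.+1) * evi theta (S (d j).+1)
      = evi theta (S (d j)) * evi theta (w j *+ p).
    by rewrite -dS DW1 evMn mulrnAr [_ * evi _ (w j)]mulrC DW -mulr_natl [in LHS]exprS; ring.
  exists y, z; split; apply: (mulfI SN0); rewrite -eqS evM mulrCA -evM.
    by rewrite D1.
  by rewrite D2 rmorphXn.
have mono (rho : L) j : rho \in s -> (j < k)%N -> evi rho (w j.+1) = 0 -> evi rho (w j) = 0.
  move=> s_rho lt_jk xj1; have [y [_ [Ey _]]] := stepW j lt_jk.
  have [[DW _ _ _] _ _] := data j (ltnW lt_jk).
  have [q Dq] : exists q, p.-1 = q.+1 by exists p.-2; rewrite prednK // -ltnS prednK ?prime_gt0.
  (* Multiply W_(j+1) (S_j^(p-1) + p y) = p W_j by W_j^(p-1) and divide by p. As W_j S_j = p v, the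
     first term contributes kappa = (p v)^(p-1) / p, so W_j^p is a multiple of W_(j+1). *)
  pose v := - (p%:R ^+ j * c); pose kappa := p%:R ^+ q * v ^+ q.+1.
  have: evi theta (w j ^+ p) = evi theta (w j.+1 * (kappa%:P + y * w j ^+ p.-1)).
    have expp (x : algC) : x ^+ p = x * x ^+ p.-1 by rewrite -exprS prednK ?prime_gt0.
    apply: (mulfI pN0); rewrite !evE expp; move: Ey.
    rewrite !evE -[RHS]mulr_natl => Ey; rewrite [LHS]mulrA -Ey.
    transitivity (evi theta (w j.+1) * ((evi theta (w j) * evi theta (S (d j))) ^+ p.-1
      + p%:R * evi theta y * evi theta (w j) ^+ p.-1)); first by rewrite exprMn; ring.
    rewrite DW.
    have -> : - (p%:R ^+ j.+1 * c%:~R) = p%:R * v%:~R :> algC.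
      by rewrite rmorphN rmorphM rmorphXn /= rmorph_nat exprS; ring.
    rewrite /kappa Dq rmorphM !rmorphXn /= rmorph_nat exprMn exprS; ring.
  move/(red _ _ _ s_rho); rewrite !evE xj1 mul0r => /eqP.
  by rewrite expf_eq0 => /andP[_ /eqP].
have mono_le (rho : L) i j : rho \in s -> (i <= j <= k)%N ->
    evi rho (w j) = 0 -> evi rho (w i) = 0.
  move=> s_rho /andP[]; elim: j => [|j IHj] in i *; first by rewrite leqn0 => /eqP->.
  rewrite leq_eqVlt => /predU1P[-> // | lt_ij] lt_jk /(mono _ _ s_rho lt_jk).
  by apply: IHj => //; apply: ltnW.
pose e i := if i is j.+1 then w j.+1 - w j else w 0%N.
pose M i := if i is j.+1 then (p ^ d j * p.-1)%N else (p ^ (r - k))%N.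
(* At rho the values of W_0, ..., W_k are zeros followed by ones, so at most one difference is
   nonzero. *)
have e_orth (rho : L) i j : rho \in s -> (i < j <= k)%N ->
    evi rho (e i) * evi rho (e j) = 0.
  case: j => [|j] s_rho /andP[] // lt_ij lt_jk; rewrite [e j.+1]/= evB.
  have [xj0 | xj1] := x01 rho j s_rho (ltnW lt_jk).
    suff -> : evi rho (e i) = 0 by rewrite mul0r.
    case: i lt_ij => [|i] lt_ij /=; rewrite ?evB.
      by rewrite (mono_le rho 0%N j) // (ltnW lt_jk).
    rewrite (mono_le rho i.+1 j) // ?(mono_le rho i j) ?subrr //.
      by rewrite (ltnW lt_jk) andbT ltnW.
    by rewrite (ltnW lt_jk) andbT.
  have [xj0 | ->] := x01 rho j.+1 s_rho lt_jk; last by rewrite xj1 subrr mulr0.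
  by rewrite (mono _ _ s_rho lt_jk xj0) in xj1; case/eqP: (oner_neq0 L).
(* A nilpotent element mod p has trace divisible by p, but the trace of e_i from
   Q(alpha^(p^(d j))), j = max(i - 1, 0), down to Q is prime to p. *)
have non_nil i N (y : {poly int}) : (i <= k)%N ->
    evi theta (e i) ^+ N <> p%:R * evi theta y.
  move=> le_ik DeN.
  have trace j (P0 : {poly rat}) (b : int) : (j <= k)%N -> (size P0 <= p ^ (k - j))%N ->
      evi theta (e i) = evq (alpha ^+ (p ^ d j)) P0 ->
      P0`_0 *+ (p ^ (k - j)) = b%:~R -> (p %| `|b|)%N.
    move=> le_jk sP0 De Db.
    apply: (@dvdn_trace_nilpotent p (p ^ d j) (p ^ (k - j)) N m%:~R alpha theta P0 (e i) y) => //.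
    - by rewrite Dd.
    by rewrite Dd // ratr_int.
  case: i => [|j] in le_ik DeN trace.
    have [[_ _ sP DWP] P0 _] := data 0%N le_ik.
    by have := trace 0%N _ _ le_ik sP DWP P0; rewrite -exprM; apply/negP/pmX.
  have [[_ _ sP DWP] P0 _] := data j (ltnW le_ik).
  have [[_ _ sP1 DWP1] P01 _] := data j.+1 le_ik.
  have Dn : (p ^ (k - j) = p * p ^ (k - j.+1))%N by rewrite -expnS -subSn.
  pose b1 : int := (m ^+ (p ^ d j.+1)) ^+ (p ^ (k - j.+1)).-1.
  pose b0 : int := (m ^+ (p ^ d j)) ^+ (p ^ (k - j)).-1.
  have /negP[] : ~~ (p %| `|b0|)%N by rewrite /b0 -exprM.
  have dvE (x : int) : (p %| `|x|)%N = (p%:Z %| x)%Z by rewrite dvdzE.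
  (* In terms of alpha^(p^(d j)), W_(j+1) is given by P_(j+1)(X^p) and has trace p b1; so e_(j+1)
     has trace p b1 - b0, where b0 is a power of m. *)
  have := trace j ((P j.+1 \Po 'X^p) - P j) (b1 *+ p - b0) (ltnW le_ik).
  rewrite !dvE rpredBl; last by rewrite -mulr_natr natz dvdz_mull.
  apply.
  - rewrite (leq_trans (size_polyD _ _)) // geq_max size_polyN sP andbT.
    rewrite (leq_trans (size_comp_poly_leq _ _)) // size_polyXn /= Dn.
    have : (0 < p ^ (k - j.+1))%N by rewrite expn_gt0 prime_gt0.
    by move: sP1 p_gt1; move: (size _) (p ^ _)%N => sz n; clear; case: sz n => [|sz] [|n] //=; nia.
  - rewrite [e _]/= evB DWP DWP1 rmorphB /= hornerD hornerN map_comp_poly.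
    by rewrite horner_comp map_polyXn hornerXn -exprM -expnSr dS.
  rewrite coefB mulrnBl P0 rmorphB; congr (_ - _).
  rewrite -horner_coef0 horner_comp hornerXn expr0n gtn_eqF ?prime_gt0 //.
  by rewrite horner_coef0 Dn mulnC mulrnA P01 rmorphMn.
have sumM : (\sum_(i < k.+1) M i = p ^ r)%N.
  have sumMl l : (\sum_(i < l.+1) M i = p ^ (r - k + l))%N.
    elim: l => [|l IHl]; first by rewrite big_ord1 addn0.
    rewrite big_ord_recr /= IHl -{1}[(p ^ (r - k + l))%N]muln1 -mulnDr add1n.
    by rewrite prednK ?prime_gt0 // addnS expnSr.
  by rewrite sumMl subnK.
have M_gt0 i : (0 < M i)%N.
  by case: i => [|j]; rewrite /M ?muln_gt0 expn_gt0 prime_gt0.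
have e_nz i : (i <= k)%N -> exists2 rho, rho \in s & evi rho (e i) != 0.
  (* With l = 0 the factor u^l is 1, so only a power of e_i is tested. *)
  move=> le_ik; have [||rho e_rho] := @non_dvd_root L s 0 (map_poly intr (e i)) 0%N.
  - by move=> rho _; rewrite rootE horner0.
  - rewrite expr0 mul1r -rmorphXn; apply/negP => /dvd_lift[y].
    by rewrite evX; apply: non_nil.
  by rewrite -has_count has_pred1; exists rho.
have e_mult i : (i <= k)%N -> exists2 rho, evi rho (e i) != 0 & (M i <= count_mem rho s)%N.
  move=> le_ik.
  have [||rho e_rho] := @non_dvd_root L s (map_poly intr t) (map_poly intr (e i)) (M i).-1.
  - by move=> rho /t0 t_rho; apply/eqP.
  - rewrite -!rmorphXn -rmorphM; apply/negP => /dvd_lift[y].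
    rewrite evM !evX => Dy.
    (* Write M, e for [M i], [e i]. Multiplying t^(M-1) e^(size s) = p y by t v and cancelling p
       gives t v y = q e^(size s). At a root of f, t = 0 forces q or e to vanish, which fails where
       e is nonzero. *)
    have reduce v q : evi theta (v * t ^+ M i) = p%:R * evi theta q ->
        (forall rho, rho \in s -> evi rho q = 0 -> evi rho (e i) = 0) -> False.
      move=> Dq qe; have [rho s_rho /eqP e_neq0] := e_nz i le_ik; apply: (e_neq0).
      have: evi theta (t * v * y) = evi theta (q * e i ^+ size s).
        apply: (mulfI pN0); rewrite !evM !evX in Dq *; rewrite [RHS]mulrA -Dq.
        rewrite mulrCA -Dy -{2}(prednK (M_gt0 i)) exprS; ring.
      move/(red _ _ _ s_rho); rewrite !evM evX t0 // !mul0r => /esym/eqP.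
      rewrite mulf_eq0 expf_eq0 => /orP[/eqP|/andP[_ /eqP //]]; exact: qe.
    case: i => [|j] in le_ik Dy reduce *.
      (* For k = r, M_0 = 1 and the claim is only that e_0 is not nilpotent modulo p. *)
      case: k_max => [Dk | pc].
        by move: Dy; rewrite /M -Dk subnn expn0 expr0 mul1r; apply: non_nil.
      have [_ [_ [u [_ _ Du]]]] := stepS (d 0%N).
      have [[DW _ _ _] _ _] := data 0%N le_ik.
      (* Substituting S_0 = t^(M_0) + p t u in W_0 S_0 = -p c gives this q; its value at each root
         is -c, nonzero as p does not divide c. *)
      apply: (reduce (w 0%N) (- c%:P - w 0%N * t * u)) => [|rho s_rho].
        move: DW; rewrite Du /M /d addn0 !evE expr1 => DW.
        by rewrite mulrBr mulrN -DW; ring.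
      rewrite !evE t0 // mulr0 mul0r subr0 => /eqP; rewrite oppr_eq0 => /eqP c0.
      have := intr_exp_ppow_pred 1 charL pc; rewrite c0 expn1 expr0n.
      by rewrite (gtn_eqF p1_gt0) => /esym/eqP; rewrite oner_eq0.
    have [_ [z [_ Ez]]] := stepW j le_ik.
    (* At each root this q takes the value W_j - W_(j+1) = -e_(j+1), since there t vanishes and the
       power of m is 1. *)
    apply: (reduce (w j.+1) (w j - w j.+1 * ((m ^+ (p ^ d j * p.-1))%:P + t * z))) => [|rho s_rho].
      rewrite /M; move: Ez; rewrite !evE -[RHS]mulr_natl => Ez.
      by rewrite mulrBr -Ez; ring.
    rewrite !evE t0 // mul0r addr0 exprM rmorphXn /=.
    have /= -> := intr_exp_ppow_pred 1 charL (pmX (p ^ d j)%N).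
    by rewrite mulr1 => /eqP; rewrite subr_eq0 => /eqP ->; rewrite subrr.
  by rewrite prednK // => ?; exists rho.
have rho_ex (i : 'I_k.+1) : exists rho : L,
    evi rho (e i) != 0 /\ (M i <= count_mem rho s)%N.
  by have [|rho e_rho M_rho] := e_mult i; [rewrite -ltnS | exists rho].
have [rho rhoP] := fin_all_exists rho_ex.
suff : (k < p)%N by rewrite ltnNge le_pk.
apply: (@num_classes_le_prime L p f s k.+1 (fun i => e i) rho (fun i => M i) charL Df).
- by move=> i; apply: M_gt0.
- move=> i j x ij x_s; have le_ord (l : 'I_k.+1) : (l <= k)%N by rewrite -ltnS.
  have [lt_ij | lt_ji | eq_ij] := ltngtP i j.
  + by rewrite e_orth // lt_ij le_ord.
  + by rewrite mulrC e_orth // lt_ji le_ord.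
  by rewrite (val_inj eq_ij) eqxx in ij.
- by move=> i; case: (rhoP i).
- by move=> i; case: (rhoP i).
by rewrite sumM.
Qed.

Theorem theorem2p3 (p r : nat) (m : int) (alpha : algC) :
  prime p -> odd p -> (0 < r)%N ->
  m != 1 -> squarefree_int m -> ~~ (p %| `|m|)%N ->
  irreducible_poly ('X^(p ^ r) - (m%:~R)%:P : {poly rat}) ->
  alpha ^+ (p ^ r) = m%:~R ->
  (p < logn p `|m ^+ (p - 1) - 1|)%N ->
  (p <= r)%N ->
  ~ monogenic alpha.
Proof.
move=> p_pr p_odd _ _ _ pm irrF Dalpha lt_nu le_pr.
have [k [c [k_bnd cN0 Dc k_max]]] := exists_level p_pr p_odd pm lt_nu le_pr.
exact: not_monogenic_of_level p_pr p_odd pm irrF Dalpha k_bnd cN0 Dc k_max.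
Qed.
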